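(* The map $\lambda\mapsto \Phi_\lambda(x)$ is a bijection from the set of order-reversing multiplicity maps onto the set of normal divisibility polynomials, and both sets are in one-to-one correspondence with the set of multiplicity labeled Hasse diagrams of finite saturated subsets of $\mathbb{N}$, the order-reversing multiplicity map $\lambda$ corresponding to the set $\Lambda=\{h\in\mathbb{N} : \lambda(h)\neq 0\}$ with label $\lambda(h)$ at each node $h\in\Lambda$.
   Context: $\mathbb{N}$ denotes the positive integers. A divisibility polynomial is a polynomial $f(x)$ with complex coefficients such that $f(x^m)\mid f(x^n)$ in $\mathbb{C}[x]$ whenever $m\mid n$. A polynomial is normal if it has leading coefficient $1$ and a non-zero constant term. A multiplicity map is a map $\lambda:\mathbb{N}\to\mathbb{N}\cup\{0\}$ that is non-zero at only finitely many integers; it is order-reversing if $h\mid h'$ implies $\lambda(h)\geq\lambda(h')$. For a multiplicity map $\lambda$, $\Phi_\lambda(x):=\prod_{h\in\mathbb{N}}\big(\Phi_h(x)\big)^{\lambda(h)}$, where $\Phi_h$ is the $h$-th cyclotomic polynomial (the zero map gives the polynomial $1$). A set $\Lambda\subset\mathbb{N}$ is saturated if $d\mid h$ and $h\in\Lambda$ imply $d\in\Lambda$. The Hasse diagram of a finite saturated set $\Lambda$ is the graph with node set $\Lambda$ and an upward edge from $h$ to $h'$ whenever $h'=ph$ for a prime $p$ (the empty set has the empty diagram). A multiplicity labeled Hasse diagram of $\Lambda$ is its Hasse diagram together with a positive integer label at each node, such that the labels do not increase when moving up along edges. *)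

(* Defs.v *)
From mathcomp Require Import all_boot all_order all_algebra.
From mathcomp Require Import all_field.
From mathcomp Require Import boolp classical_sets functions cardinality fsbigop.
From mathcomp Require Import reals.
From mathcomp Require Import complex.

Set Implicit Arguments.
Unset Strict Implicit.
Unset Printing Implicit Defensive.

Import Order.TTheory GRing.Theory Num.Theory.

Local Open Scope classical_set_scope.
Local Open Scope ring_scope.
Local Open Scope complex_scope.

Definition posnat := {n : nat | (0 < n)%N}.

Section Polynomials.
Variable R : realType.

Definition divisibility_poly (f : {poly R[i]}) : Prop :=
  forall m n : posnat, (val m %| val n)%N ->
    f \Po 'X^(val m) %| f \Po 'X^(val n).

Definition normal_poly (f : {poly R[i]}) : Prop :=
  f \is monic /\ f`_0 != 0.

Definition normal_divisibility_polys : set {poly R[i]} :=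
  [set f | normal_poly f /\ divisibility_poly f].

Definition cyclotomic_poly (h : posnat) : {poly R[i]} :=
  map_poly intr 'Phi_(val h).

(* The product over a classical set is the finite product over the indices   *)
(* with factor different from 1; for lam of finite support these are exactly *)
(* the h with lam h != 0.  (It is 1 when infinitely many factors differ      *)
(* from 1, a case that does not arise for multiplicity maps.)                *)
Definition Phi (lam : posnat -> nat) : {poly R[i]} :=
  \big[*%R/1]_(h \in [set: posnat]) (cyclotomic_poly h) ^+ lam h.

End Polynomials.

Arguments normal_divisibility_polys R : clear implicits.
Arguments Phi R lam : clear implicits.

Definition mult_support (lam : posnat -> nat) : set posnat :=
  [set h | lam h != 0%N].

Definition multiplicity_map (lam : posnat -> nat) : Prop :=
  finite_set (mult_support lam).

Definition order_reversing (lam : posnat -> nat) : Prop :=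
  forall h h' : posnat, (val h %| val h')%N -> (lam h' <= lam h)%N.

Definition order_reversing_maps : set (posnat -> nat) :=
  [set lam | multiplicity_map lam /\ order_reversing lam].

Definition saturated (L : set posnat) : Prop :=
  forall d h : posnat, (val d %| val h)%N -> L h -> L d.

(* edge h h' is an edge directed upwards from h to h'. *)
Record digraph := Digraph {
  node : set posnat;
  edge : node -> node -> Prop
}.

Definition hasse_diagram (L : set posnat) : digraph :=
  @Digraph L (fun h h' : L =>
    exists2 p : nat, prime p & val (val h') = (p * val (val h))%N).

Record labeled_digraph := LabeledDigraph {
  graph_of : digraph;
  label : node graph_of -> posnat
}.

Definition mult_labeled_hasse_diagrams : set labeled_digraph :=
  [set D | (exists L : set posnat,
              [/\ finite_set L, saturated L & graph_of D = hasse_diagram L])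
           /\ forall h h' : node (graph_of D),
                edge h h' -> (val (label h') <= val (label h))%N].

Lemma mult_support_gt0 (lam : posnat -> nat) (h : mult_support lam) :
  (0 < lam (val h))%N.
Proof. by rewrite lt0n; exact: set_valP h. Qed.

Definition diagram_of (lam : posnat -> nat) : labeled_digraph :=
  @LabeledDigraph (hasse_diagram (mult_support lam))
    (fun h : mult_support lam => exist _ (lam (val h)) (mult_support_gt0 h)).

(* Main.v *)
(* Everything is read off the multiplicities of roots.  For a <> 0 the
   multiplicity of a in f(X^n) is that of a^n in f, so a normal f is a
   divisibility polynomial iff mult(a^m, f) <= mult(a^n, f) for all a <> 0 and
   m | n.  With m = 1 this makes the finite set of roots closed under powers, so
   all roots are roots of unity; the primitive h-th roots of unity are powers of
   one another, hence share a multiplicity lambda(h), and lambda is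
   order-reversing since z^(h'/h) is a primitive h-th root of unity when z is a
   primitive h'-th one and h | h'.  Conversely a primitive h-th root of unity
   has multiplicity lambda(h) in Phi_lambda, and no other numbers are roots. *)
Require Import Defs.
From mathcomp Require Import all_boot all_order all_algebra.
From mathcomp Require Import all_field.
From mathcomp Require Import finmap.
From mathcomp Require Import boolp classical_sets functions cardinality fsbigop.
From mathcomp Require Import reals complex.
From mathcomp Require Import zify.

Set Implicit Arguments.
Unset Strict Implicit.
Unset Printing Implicit Defensive.

Import Order.TTheory GRing.Theory Num.Theory.

Local Open Scope ring_scope.

(** * Root multiplicities over an algebraically closed field, and roots of unity *)

Section RootMultiplicities.
Variable C : numClosedFieldType.
Implicit Types (p q : {poly C}) (a : C).

Lemma dvdp_leq_mup a p q : q != 0 -> p %| q -> (mup a p <= mup a q)%N.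
Proof.
move=> q0 pq; have p0 : p != 0.
  by apply: contraNneq q0 => p0; rewrite -dvd0p -p0.
by rewrite mup_geq //; apply: dvdp_trans pq; rewrite -mup_geq.
Qed.

(** Both polynomials split into linear factors, and the multiplicity of [a] counts its occurrences
    in the list of roots. The roots of [p] thus form a sub-multiset of those of [q], and the
    leftover roots give the cofactor. *)
Lemma leq_mup_dvdp p q : p != 0 -> q != 0 ->
  (forall a, mup a p <= mup a q)%N -> p %| q.
Proof.
have [r ->] := closed_field_poly_normal p.
have [s ->] := closed_field_poly_normal q.
rewrite !scaler_eq0 !negb_or => /andP[p0 _] /andP[q0 _].
rewrite dvdpZl // dvdpZr // => le_pq.
have le_rs a : (count_mem a r <= count_mem a s)%N.
  have := le_pq a; rewrite -!mul_polyC !mupMr ?rootC //.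
  by rewrite !mu_prod_XsubC.
have /count_subseqP[r' /perm_to_subseq[t st] rr'] := le_rs.
by rewrite (perm_big _ st) big_cat /= (perm_big _ rr') dvdp_mulr.
Qed.

Lemma monic_mup_inj p q : p \is monic -> q \is monic ->
  (forall a, mup a p = mup a q) -> p = q.
Proof.
move=> mp mq mup_pq; apply/eqP; rewrite -eqp_monic //.
by rewrite /eqp !leq_mup_dvdp ?monic_neq0 // => a; rewrite mup_pq.
Qed.

Lemma mup_expX p n a : p != 0 -> mup a (p ^+ n) = (n * mup a p)%N.
Proof.
move=> p0; elim: n => [|n IHn]; first by rewrite mupNroot // root1.
by rewrite exprS mupM ?expf_neq0 // IHn mulSn.
Qed.

Lemma mup_prod (I : eqType) (s : seq I) (F : I -> {poly C}) a :
    (forall i, F i != 0) ->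
  mup a (\prod_(i <- s) F i) = (\sum_(i <- s) mup a (F i))%N.
Proof.
move=> F0; elim: s => [|i s IHs]; first by rewrite !big_nil mupNroot // root1.
by rewrite !big_cons mupM ?IHs // prodf_seq_neq0; apply/allP => j _; rewrite F0.
Qed.

(** After removal of one factor X - a, the cofactor takes the value n a^(n-1) at [a], which is
    non-zero in characteristic 0. *)
Lemma mup_subXn a n : (0 < n)%N -> a != 0 -> mup a ('X^n - (a ^+ n)%:P) = 1%N.
Proof.
move=> n0 a0; rewrite polyC_exp subrXX mupMl.
  by rewrite (@mup_XsubCX _ 1) eqxx.
rewrite /root horner_sum (eq_bigr (fun=> a ^+ n.-1)) => [|i _].
  by rewrite sumr_const card_ord mulrn_eq0 negb_or -lt0n n0 expf_neq0.
rewrite -polyC_exp hornerM hornerXn hornerC -exprD; congr (_ ^+ _).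
  by have := ltn_ord i; lia.
Qed.

Lemma comp_polyXn_eq0 p n : (0 < n)%N -> (p \Po 'X^n == 0) = (p == 0).
Proof. by move=> n0; rewrite comp_poly_eq0 // size_polyXn. Qed.

(** Write p = q (X - a^n)^k with q(a^n) non-zero. Then p(X^n) = q(X^n) (X^n - a^n)^k, where [a] is
    not a root of the first factor and is a simple root of X^n - a^n. *)
Lemma mup_comp_polyXn p n a : (0 < n)%N -> a != 0 -> p != 0 ->
  mup a (p \Po 'X^n) = mup (a ^+ n) p.
Proof.
move=> n0 a0 p0; have [k [q]] := multiplicity_XsubC p (a ^+ n).
rewrite p0 /= => qan ->.
rewrite comp_polyM rmorphXn /= comp_polyB comp_polyX comp_polyC.
rewrite !mupMr ?mup_XsubCX ?eqxx //.
  by rewrite mup_expX ?mup_subXn ?muln1 // -size_poly_gt0 size_XnsubC.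
by rewrite /root horner_comp hornerXn.
Qed.

(* X^n - 1 is the product of the Phi_d for d | n and is separable, so each of
   its roots is a root of exactly one of these Phi_d. *)
Lemma mup_Cyclotomic h a : (0 < h)%N ->
  mup a (map_poly intr 'Phi_h) = h.-primitive_root a.
Proof.
pose P n : {poly C} := map_poly intr 'Phi_n.
have Pm n : P n \is monic by rewrite monic_map // Cyclotomic_monic.
have P0 n : P n != 0 by rewrite monic_neq0.
have sumP n : (0 < n)%N ->
    (\sum_(d <- divisors n) mup a (P d))%N = (a ^+ n == 1).
  move=> n0; rewrite -mup_prod // -rmorph_prod /= prod_Cyclotomic //.
  rewrite rmorphB rmorph1 /= map_polyXn.
  have [an1|an1] := eqVneq (a ^+ n) 1; last first.
    by rewrite mupNroot // /root !hornerE subr_eq0.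
  rewrite -[1]polyC1 -an1 mup_subXn //.
  by apply: contra_eq_neq an1 => ->; rewrite expr0n gtn_eqF // eq_sym oner_neq0.
have exists_P n : (0 < n)%N -> mup a (P n) != 0%N -> a ^+ n = 1.
  move=> n0 an; apply/eqP; apply: contraNT an => an1.
  by move: (sumP n n0); rewrite (negPf an1) (big_rem n) ?divisors_id //=; lia.
have prim_P n : n.-primitive_root a -> mup a (P n) = 1%N.
  move=> pa; have n0 := prim_order_gt0 pa.
  have := sumP n n0.
  rewrite prim_expr_order // eqxx (big_rem n) ?divisors_id //=.
  rewrite big_seq big1 ?addn0 // => d.
  rewrite (mem_rem_uniq _ (divisors_uniq n)) inE /= -dvdn_divisors //.
  move=> /andP[dn d_n].
  apply/eqP; apply: contraNT dn => ad; rewrite eqn_dvd d_n.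
  by rewrite (prim_order_dvd pa) exists_P ?eqxx // (dvdn_gt0 n0).
move=> h0; rewrite -/(P h); have [pa|npa] := boolP (h.-primitive_root a).
  by rewrite prim_P.
apply/eqP; apply: contraNT npa => ah.
(* If the order [d] of [a] differed from [h], both Phi_d and Phi_h would contribute to a sum equal
   to 1. *)
have ah1 := exists_P h h0 ah; have [d pd dh] := prim_order_exists h0 ah1.
have := sumP h h0; rewrite ah1 eqxx (big_rem h) ?divisors_id //=.
have [<- //|d_h] := eqVneq d h.
rewrite (big_rem d) /=; last first.
  by rewrite (mem_rem_uniq _ (divisors_uniq h)) inE /= d_h -dvdn_divisors.
by rewrite (prim_P d pd); lia.
Qed.

Lemma rootE_mup p a : p != 0 -> root p a = (0 < mup a p)%N.
Proof. by move=> p0; rewrite -dvdp_XsubCl XsubC_dvd. Qed.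

Lemma prim_root_exists n : (0 < n)%N -> exists z : C, n.-primitive_root z.
Proof.
move=> n0; pose P : {poly C} := map_poly intr 'Phi_n.
have mP : P \is monic by rewrite monic_map // Cyclotomic_monic.
have /closed_rootP[z] : size P != 1%N.
  rewrite size_map_inj_poly ?size_Cyclotomic //; last exact: intr_inj.
  by rewrite eqSS -lt0n totient_gt0.
rewrite rootE_mup ?monic_neq0 // mup_Cyclotomic // lt0b => zn.
by exists z.
Qed.

Lemma prim_root_order_inj (m n : nat) a :
  m.-primitive_root a -> n.-primitive_root a -> m = n.
Proof.
move=> ma na; apply/eqP; rewrite eqn_dvd.
by rewrite (prim_order_dvd ma) (prim_order_dvd na) !prim_expr_order ?eqxx.
Qed.

Lemma prim_root_neq0 n a : n.-primitive_root a -> a != 0.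
Proof.
move=> an; have n0 := prim_order_gt0 an.
have /eqP := prim_expr_order an.
by apply: contraTneq => ->; rewrite expr0n gtn_eqF // eq_sym oner_neq0.
Qed.

Lemma prim_root_expX n a b : n.-primitive_root a -> n.-primitive_root b ->
  exists2 k, (0 < k)%N & b = a ^+ k.
Proof.
move=> an bn; have [i ->] := prim_rootP an (prim_expr_order bn).
(* The exponent [i] may be 0; adding the order makes it positive. *)
exists (i + n)%N; first by rewrite addn_gt0 (prim_order_gt0 an) orbT.
by rewrite exprD (prim_expr_order an) mulr1.
Qed.

(** A non-zero [p] has fewer than [size p] distinct roots, so two of the first [size p] powers of
    [a] coincide. Cancelling the smaller one leaves a positive power of [a] equal to 1. *)
Lemma all_powers_root_prim p a : p != 0 -> a != 0 ->
  (forall n, (0 < n)%N -> root p (a ^+ n)) ->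
  exists2 n, (0 < n)%N & n.-primitive_root a.
Proof.
move=> p0 a0 root_p; pose rs := [seq a ^+ i | i <- iota 1 (size p)].
have : ~~ uniq rs.
  apply/negP => u; have := max_poly_roots p0 _ u.
  rewrite size_map size_iota ltnn => /(_ _)/notF; apply.
  apply/allP => _ /mapP[i + ->]; rewrite mem_iota => /andP[i0 _].
  exact: root_p.
case/(uniqPn 0) => i [j []] ij; rewrite size_map size_iota => jp.
rewrite !(nth_map 0%N) ?size_iota ?(ltn_trans ij) //.
rewrite !nth_iota ?(ltn_trans ij) //.
move=> e; have /prim_order_exists[|n an _] : a ^+ (j - i) = 1.
- apply: (mulfI (expf_neq0 (1 + i) a0)).
  by rewrite mulr1 -exprD -addnA subnKC // ltnW.
- by rewrite subn_gt0.
by exists n => //; exact: prim_order_gt0 an.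
Qed.

End RootMultiplicities.

(** * Cyclotomic products and normal divisibility polynomials *)

Section CyclotomicProducts.
Variable R : realType.
Local Notation C := R[i]%C.
Implicit Types (f : {poly C}) (lam : posnat -> nat) (h : posnat) (a : C).
Local Open Scope classical_set_scope.

Lemma monic_cyclotomic_poly h : cyclotomic_poly R h \is monic.
Proof. by rewrite monic_map // Cyclotomic_monic. Qed.

Lemma PhiE lam : multiplicity_map lam ->
  Phi R lam =
  \prod_(h <- fset_set (mult_support lam)) cyclotomic_poly R h ^+ lam h.
Proof.
move=> fin; rewrite /Phi (fsbigTE (fset_set (mult_support lam))) // => h.
rewrite in_fset_set // notin_setE /mult_support /= => /negP.
by rewrite negbK => /eqP->.
Qed.

Lemma monic_Phi lam : multiplicity_map lam -> Phi R lam \is monic.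
Proof.
move=> fin; rewrite PhiE //; apply: rpred_prod => h _.
by rewrite rpredX // monic_cyclotomic_poly.
Qed.

Lemma mup_PhiE lam a : multiplicity_map lam ->
  mup a (Phi R lam) =
  (\sum_(h <- fset_set (mult_support lam)) lam h * (val h).-primitive_root a)%N.
Proof.
move=> fin; have cyc0 h : cyclotomic_poly R h != 0.
  exact: monic_neq0 (monic_cyclotomic_poly h).
rewrite PhiE // mup_prod => [|h]; last by rewrite expf_neq0.
by apply: eq_bigr => h _; rewrite mup_expX // mup_Cyclotomic // (valP h).
Qed.

Lemma mup_Phi lam h a : multiplicity_map lam -> (val h).-primitive_root a ->
  mup a (Phi R lam) = lam h.
Proof.
move=> fin ha; rewrite mup_PhiE; last exact: fin.
have other k : k != h -> (lam k * (val k).-primitive_root a)%N = 0%N.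
  case: (boolP (_.-primitive_root a)) => [ka|]; last by rewrite muln0.
  by rewrite (val_inj (prim_root_order_inj ka ha)) eqxx.
have [hs|hs] := boolP (h \in fset_set (mult_support lam)).
  rewrite (bigD1_seq h hs (fset_uniq _)) ha muln1 big1 => [|k kh].
    by rewrite /= addn0.
  exact: other.
rewrite big_seq big1 => [|k ks]; last first.
  by rewrite other //; apply: contraNneq hs => <-.
move: hs; rewrite in_fset_set // notin_setE /mult_support /=.
by move=> /negP; rewrite negbK => /eqP->.
Qed.

Lemma mup_Phi_eq0 lam a : multiplicity_map lam ->
  (forall n, (0 < n)%N -> ~~ n.-primitive_root a) -> mup a (Phi R lam) = 0%N.
Proof.
move=> fin na; rewrite mup_PhiE // big1 // => h _.
by rewrite (negPf (na _ (valP h))) muln0.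
Qed.

Lemma prim_root_dec a :
  (exists h, (val h).-primitive_root a) \/
  (forall n, (0 < n)%N -> ~~ n.-primitive_root a).
Proof.
have [[h ha]|ex] := pselect (exists h, (val h).-primitive_root a).
  by left; exists h.
right=> n n0; apply/negP => na; apply: ex.
by exists (exist (fun n => 0 < n)%N n n0).
Qed.

Lemma normal_neq0 f : normal_poly f -> f != 0.
Proof. by case=> /monic_neq0. Qed.

Lemma normal_mup0 f : normal_poly f -> mup 0 f = 0%N.
Proof. by case=> _ f0; rewrite mupNroot // /root horner_coef0. Qed.

Lemma divisibility_polyP f : normal_poly f ->
  divisibility_poly f <->
  forall (m n : posnat) a, (val m %| val n)%N -> a != 0 ->
    (mup (a ^+ val m) f <= mup (a ^+ val n) f)%N.
Proof.
move=> fn; have f0 := normal_neq0 fn; split=> [df m n a mn a0|H m n mn].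
  rewrite -!mup_comp_polyXn ?(valP m) ?(valP n) //.
  by rewrite dvdp_leq_mup ?comp_polyXn_eq0 ?(valP n) // df.
apply: leq_mup_dvdp; rewrite ?comp_polyXn_eq0 ?(valP n) ?(valP m) // => a.
have [->|a0] := eqVneq a 0; last first.
  rewrite (mup_comp_polyXn (valP m) a0 f0).
  by rewrite (mup_comp_polyXn (valP n) a0 f0) H.
(* At 0 the value of f(X^m) is the constant term of [f], so normality makes the left multiplicity
   0. *)
rewrite mupNroot // /root horner_comp hornerXn expr0n gtn_eqF ?(valP m) //.
by rewrite horner_coef0; case: fn.
Qed.

(** The choice is arbitrary; by [mup_root_mult] it does not affect multiplicities in a normal
    divisibility polynomial. *)
Definition unit_root h : C := sval (cid (prim_root_exists C (valP h))).

Lemma unit_rootP h : (val h).-primitive_root (unit_root h).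
Proof. by rewrite /unit_root; case: cid. Qed.

Definition root_mult f : posnat -> nat := fun h => mup (unit_root h) f.

Lemma Phi_normal_divisibility lam : order_reversing_maps lam ->
  normal_divisibility_polys R (Phi R lam).
Proof.
case=> fin rev; have mPhi := monic_Phi fin.
have nPhi : normal_poly (Phi R lam).
  split=> //; rewrite -horner_coef0 -[_ == 0]/(root _ 0).
  rewrite rootE_mup ?monic_neq0 //.
  rewrite -eqn0Ngt mup_Phi_eq0 // => n n0.
  by apply/negP => /prim_root_neq0; rewrite eqxx.
split=> //; apply/(divisibility_polyP nPhi) => m n a mn _.
have [[h hm]|am] := prim_root_dec (a ^+ val m); last by rewrite mup_Phi_eq0.
have [q nq] := dvdnP mn.
(* Since a^n = (a^m)^q, its order is h / gcd(q, h), a divisor of [h], to which [lam] gives at least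
   the value [lam h]. *)
have hn := exp_prim_root hm q; rewrite -exprM mulnC -nq in hn.
pose k : posnat := exist (fun n => 0 < n)%N _ (prim_order_gt0 hn).
rewrite (mup_Phi fin hm) (mup_Phi (h := k) fin hn); apply: rev => /=.
exact: dvdn_div (dvdn_gcdr _ _).
Qed.

Lemma PhiK lam : multiplicity_map lam -> root_mult (Phi R lam) = lam.
Proof.
move=> fin; apply/funext => h.
exact: mup_Phi fin (unit_rootP h).
Qed.

(** * Recovering a normal divisibility polynomial from its root multiplicities *)

Section NormalDivisibility.
Variable f : {poly C}.
Hypothesis fP : normal_divisibility_polys R f.

Lemma leq_mup_exp a n : (0 < n)%N -> a != 0 -> (mup a f <= mup (a ^+ n) f)%N.
Proof.
case: fP => fn /(divisibility_polyP fn) df n0 a0.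
exact: (df (exist (fun n => 0 < n)%N 1%N isT)
           (exist (fun n => 0 < n)%N n n0) a).
Qed.

Lemma mup_root_mult h a : (val h).-primitive_root a -> mup a f = root_mult f h.
Proof.
move=> ha; have hz := unit_rootP h.
have [[k k0 ek] [l l0 el]] := (prim_root_expX ha hz, prim_root_expX hz ha).
apply/eqP; rewrite eqn_leq /root_mult; apply/andP; split.
  by rewrite ek; exact: leq_mup_exp k0 (prim_root_neq0 ha).
by rewrite el; exact: leq_mup_exp l0 (prim_root_neq0 hz).
Qed.

Lemma root_prim a : root f a -> exists h, (val h).-primitive_root a.
Proof.
have [fn _] := fP; have f0 := normal_neq0 fn => fa.
have a0 : a != 0.
  by apply: contraTneq fa => ->; rewrite rootE_mup // normal_mup0.
have [|n n0 an] := @all_powers_root_prim _ f a f0 a0; last first.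
  by exists (exist (fun n => 0 < n)%N n n0).
move=> n n0; move: fa; rewrite !(rootE_mup _ f0) => fa.
exact: leq_trans fa (leq_mup_exp n0 a0).
Qed.

Lemma root_mult_order_reversing : order_reversing_maps (root_mult f).
Proof.
have [fn _] := fP; have f0 := normal_neq0 fn.
split=> [|h h' /dvdnP[q qh]].
  have [r fr] := closed_field_poly_normal f.
  (* [g] sends a root of unity to its order, with junk value 1 elsewhere. The support of
     [root_mult f] lies in the image under [g] of the finite list of roots. *)
  pose g a := xget (exist (fun n => 0 < n)%N 1%N isT)
                  [set h : posnat | (val h).-primitive_root a].
  apply: (@sub_finite_set _ _ (g @` [set` r])); last first.
    exact/finite_image/finite_seq.
  move=> h; rewrite /mult_support /= -lt0n /root_mult -rootE_mup // => zr.
  exists (unit_root h).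
    by move: zr; rewrite {1}fr rootZ ?lead_coef_eq0 // root_prod_XsubC.
  rewrite /g; case: xgetP => [k -> /= kz|/(_ h)[]]; last exact: unit_rootP.
  by apply/val_inj; apply: prim_root_order_inj kz (unit_rootP h).
have q0 : (0 < q)%N by have := valP h'; rewrite qh muln_gt0 => /andP[].
have hz' := unit_rootP h'.
have hz : (val h).-primitive_root (unit_root h' ^+ q).
  have dh : (val h %| val h')%N by rewrite qh dvdn_mull.
  by have := dvdn_prim_root hz' dh; rewrite {1}qh mulnK // (valP h).
by rewrite -(mup_root_mult hz); exact: leq_mup_exp q0 (prim_root_neq0 hz').
Qed.

Lemma root_multK : Phi R (root_mult f) = f.
Proof.
have [[fm _] _] := fP; have [fin _] := root_mult_order_reversing.
apply: monic_mup_inj => [||a]; rewrite ?monic_Phi //.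
have [[h ha]|na] := prim_root_dec a.
  by rewrite (mup_Phi fin ha) (mup_root_mult ha).
rewrite mup_Phi_eq0 // mupNroot //; apply/negP => /root_prim[h ha].
by have := na _ (valP h); rewrite ha.
Qed.

End NormalDivisibility.

Lemma Phi_bij :
  set_bij order_reversing_maps (normal_divisibility_polys R) (Phi R).
Proof.
split=> [lam /Phi_normal_divisibility //|lam mu|f fP].
  by rewrite !inE => -[/PhiK lamK _] [/PhiK muK _] e; rewrite -lamK e.
by exists (root_mult f); [exact: root_mult_order_reversing | exact: root_multK].
Qed.

Lemma root_mult_bij :
  set_bij (normal_divisibility_polys R) order_reversing_maps root_mult.
Proof.
split=> [f /root_mult_order_reversing //|f g|lam lamP].
  by rewrite !inE => /root_multK fK /root_multK gK e; rewrite -fK e.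
by exists (Phi R lam); [exact: Phi_normal_divisibility | case: lamP => /PhiK].
Qed.

End CyclotomicProducts.

(** * Order-reversing maps and labeled Hasse diagrams *)

Section Diagrams.
Local Open Scope classical_set_scope.
Implicit Types (L : set posnat) (lam : posnat -> nat).

Definition map_of_labels L (l : L -> posnat) : posnat -> nat :=
  fun h => if pselect (L h) is left Lh
           then val (l (SigSub (mem_set Lh))) else 0%N.

Definition map_of_diagram (D : labeled_digraph) : posnat -> nat :=
  map_of_labels (@label D).

Lemma map_of_labelsE L (l : L -> posnat) (h : L) :
  map_of_labels l (val h) = val (l h).
Proof.
rewrite /map_of_labels; case: pselect => [Lh|]; last by case; exact: set_valP.
by congr (val (l _)); exact/val_inj.
Qed.

(** Labels are positive, so the extension by 0 vanishes exactly off [L]. *)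
Lemma mult_support_map_of_labels L (l : L -> posnat) :
  mult_support (map_of_labels l) = L.
Proof.
apply/seteqP; split=> h; rewrite /mult_support /=.
  by rewrite /map_of_labels; case: pselect.
move=> Lh; rewrite -[h]/(val (SigSub (mem_set Lh) : L)).
by rewrite map_of_labelsE -lt0n (valP (l _)).
Qed.

Lemma diagram_ofK : cancel diagram_of map_of_diagram.
Proof.
move=> lam; apply/funext => h; rewrite /map_of_diagram /map_of_labels /=.
case: pselect => //= lh; apply/esym/eqP; exact: contra_notT lh.
Qed.

(** The type of a labeling depends on its node set, so [l] and [l'] are compared at nodes with the
    same underlying integer until [L = L'] is eliminated. *)
Lemma eq_labeled_hasse_diagram L L' (l : L -> posnat) (l' : L' -> posnat) :
    L = L' -> (forall (h : L) (h' : L'), val h = val h' -> l h = l' h') ->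
  @LabeledDigraph (hasse_diagram L) l = @LabeledDigraph (hasse_diagram L') l'.
Proof.
move=> e; case: _ / e in l' * => ll'.
by congr LabeledDigraph; apply/funext => h; apply: ll'.
Qed.

Lemma map_of_labelsK L (l : L -> posnat) :
  diagram_of (map_of_labels l) = @LabeledDigraph (hasse_diagram L) l.
Proof.
apply: eq_labeled_hasse_diagram => [|h h' hh'].
  exact: mult_support_map_of_labels.
by apply/val_inj; rewrite /= hh' map_of_labelsE.
Qed.

Lemma diagram_of_order_reversing lam : order_reversing_maps lam ->
  mult_labeled_hasse_diagrams (diagram_of lam).
Proof.
case=> fin rev; split=> [|h h' [p _ hp]]; last first.
  by apply: rev; rewrite hp dvdn_mull.
exists (mult_support lam); split=> // d h dh.
by rewrite /mult_support /= -!lt0n => /leq_trans; apply; exact: rev.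
Qed.

(* Divisibility is generated by multiplication by primes, and saturation keeps
   the intermediate divisors inside [L]. *)
Lemma labels_order_reversing L (l : L -> posnat) : saturated L ->
    (forall h h' : L,
      (exists2 p, prime p & val (val h') = (p * val (val h))%N) ->
      (val (l h') <= val (l h))%N) ->
  order_reversing (map_of_labels l).
Proof.
move=> satL step h h' /dvdnP[q]; elim/ltn_ind: q h' => q IHq h' qh.
have [Lh'|Lh'] := pselect (L h'); last first.
  by rewrite {1}/map_of_labels; case: pselect.
have [q0|q1|q1] := ltngtP q 1.
- by have := valP h'; rewrite qh; move: q0; rewrite ltnS leqn0 => /eqP->.
(* With [p] the least prime factor of q = h'/h, the node k = h'/p is one edge below [h'], and the
   induction hypothesis for q/p compares it with [h]. *)
- have pq := pdiv_dvd q; have pp := pdiv_prime q1.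
  set p := pdiv q in pq pp; have q0 : (0 < q)%N by exact: ltnW.
  have k0 : (0 < q %/ p * val h)%N.
    by rewrite muln_gt0 (valP h) divn_gt0 ?prime_gt0 // dvdn_leq.
  pose k : posnat := exist (fun n => 0 < n)%N _ k0.
  have kh' : val h' = (p * val k)%N.
    by rewrite qh /= mulnA muln_divA // mulKn ?prime_gt0.
  have Lk : L k by apply: satL Lh'; rewrite kh' dvdn_mull.
  apply: leq_trans (IHq (q %/ p)%N _ k erefl); last first.
    by rewrite ltn_Pdiv ?prime_gt1.
  rewrite -[h']/(val (SigSub (mem_set Lh') : L)).
  rewrite -[k]/(val (SigSub (mem_set Lk) : L)).
  by rewrite !map_of_labelsE step //; exists p.
- by rewrite (_ : h' = h) //; apply/val_inj; rewrite qh q1 mul1n.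
Qed.

Lemma diagram_of_bij :
  set_bij order_reversing_maps mult_labeled_hasse_diagrams diagram_of.
Proof.
split=> [lam /diagram_of_order_reversing //||].
  by move=> lam mu _ _ /(can_inj diagram_ofK).
case=> G l [[L [/= finL satL GL]] step]; rewrite {}GL in l step *.
exists (map_of_labels l); last exact: map_of_labelsK.
split; last exact: labels_order_reversing.
by rewrite /multiplicity_map mult_support_map_of_labels.
Qed.

End Diagrams.

Theorem corollary1 (R : realType) :
  [/\ set_bij order_reversing_maps (normal_divisibility_polys R) (Phi R),
      set_bij order_reversing_maps mult_labeled_hasse_diagrams diagram_of
    & exists2 G : {poly R[i]%C} -> labeled_digraph,
        set_bij (normal_divisibility_polys R) mult_labeled_hasse_diagrams G
        & forall lam : posnat -> nat,
            order_reversing_maps lam -> G (Phi R lam) = diagram_of lam].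
Proof.
split; [exact: Phi_bij | exact: diagram_of_bij |].
(* Passing through [root_mult], the inverse of [Phi R], makes the three correspondences commute. *)
exists (diagram_of \o @root_mult R).
  exact: set_bij_comp (root_mult_bij R) diagram_of_bij.
by move=> lam [fin _] /=; rewrite PhiK.
Qed.
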